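(* Let $\chi$ be an uncountable limit cardinal, and let $\lambda$ be a cardinal greater than $\chi$. Suppose that $\chi^+$ is a $\lambda$-revision cardinal. Then for any large enough cardinal $\sigma<\chi$ (that is, there is an infinite cardinal $\sigma_0<\chi$ such that for all cardinals $\sigma$ with $\sigma_0\leq\sigma<\chi$), $$u(\sigma,\lambda)=\max\{u(\sigma,\chi),u(\chi^+,\lambda)\}.$$
   Context: For a set $S$ and a cardinal $\tau$, $P_\tau(S)=\{x\subseteq S : |x|<\tau\}$. For cardinals $\rho_1,\rho_2,\rho_3,\rho_4$ with $\rho_1^+\geq\rho_2$, $\rho_2^+\geq\rho_3\geq\omega$ and $\rho_3\geq\rho_4\geq 2$, the covering number $\mathrm{cov}(\rho_1,\rho_2,\rho_3,\rho_4)$ is the least cardinality of any $X\subseteq P_{\rho_2}(\rho_1)$ such that for any $b\in P_{\rho_3}(\rho_1)$ there is $Q\in P_{\rho_4}(X)$ with $b\subseteq\bigcup Q$. For infinite cardinals $\chi\leq\lambda$, $\chi$ is a $\lambda$-revision cardinal if $\mathrm{cov}(\lambda,\chi,\chi,\sigma)\leq\lambda$ for some cardinal $\sigma<\chi$ (with $\sigma\geq 2$). For infinite cardinals $\sigma\leq\lambda$, $u(\sigma,\lambda)=\mathrm{cov}(\lambda,\sigma,\sigma,\omega)$. *)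

(* Defs.v *)
From HB Require Import structures.
From mathcomp Require Import all_boot all_order.
From mathcomp Require Import boolp classical_sets functions cardinality.

Set Implicit Arguments.
Unset Strict Implicit.
Unset Printing Implicit Defensive.

Import Order.TTheory.
Local Open Scope classical_set_scope.
Local Open Scope card_scope.
Local Open Scope order_scope.

(* A cardinal is an equipotence class of types, so that Leibniz equality on   *)
(* [cardinal] is equality of cardinals.                                       *)
(* Universes: the types being counted live in a universe strictly below the   *)
(* one of [set] and [choiceType]. Hence sets of sets are counted below in the *)
(* form [(T -> Prop) -> Prop]: [card_of (set T)] is a universe inconsistency, *)
(* [card_of (T -> Prop)] is fine.                                             *)
Record cardinal := Cardinal {
  in_cardinal : Type -> Prop;
  cardinalP : exists T : Type,
    in_cardinal = (fun U : Type => [set: U] #= [set: T])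
}.

Lemma cardinal_eqP (k m : cardinal) : in_cardinal k = in_cardinal m -> k = m.
Proof.
by case: k m => [K kP] [M mP] /= e; subst M; congr Cardinal; exact: Prop_irrelevance.
Qed.

Definition card_of (T : Type) : cardinal :=
  @Cardinal (fun U : Type => [set: U] #= [set: T]) (ex_intro _ T erefl).

Definition card_of_set (S : Type) (A : S -> Prop) : cardinal := card_of {x : S | A x}.

(* A set of cardinality [k]; the choice is immaterial up to a bijection. *)
Definition carrier (k : cardinal) : Type := projT1 (cid (cardinalP k)).

Coercion carrier : cardinal >-> Sortclass.

Lemma carrierK (k : cardinal) : card_of (carrier k) = k.
Proof.
by apply: cardinal_eqP; rewrite /carrier /=; case: (cid _) => T /= ->.
Qed.

Lemma card_of_eqP (T U : Type) : (card_of T = card_of U) <-> [set: T] #= [set: U].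
Proof.
split=> [e|e].
  by have := card_eqxx [set: T] : in_cardinal (card_of T) T; rewrite e.
apply: cardinal_eqP => /=; apply/funext => V; apply/propext.
by rewrite (card_eqr e).
Qed.

Definition cardinal_le (k m : cardinal) : bool :=
  [set: carrier k] #<= [set: carrier m].

Lemma cardinal_lexx : reflexive cardinal_le.
Proof. by move=> k; exact: card_lexx. Qed.

Lemma cardinal_le_anti : antisymmetric cardinal_le.
Proof.
move=> k m /andP[km mk]; rewrite -(carrierK k) -(carrierK m).
exact/card_of_eqP/Cantor_Bernstein.
Qed.

Lemma cardinal_le_trans : transitive cardinal_le.
Proof. by move=> m k n; exact: card_le_trans. Qed.

HB.instance Definition _ := gen_eqMixin cardinal.
HB.instance Definition _ := gen_choiceMixin cardinal.

Fact cardinal_display : Order.disp_t. Proof. exact: (Order.Disp tt tt). Qed.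

HB.instance Definition _ := Order.Le_isPOrder.Build cardinal_display cardinal
  cardinal_lexx cardinal_le_anti cardinal_le_trans.


Lemma inj_cardinal_le (k m : cardinal) (f : k -> m) : injective f -> k <= m.
Proof.
move=> finj; have [g] : $|{injfun [set: k] >-> [set: m]}|.
  by apply/injfunPex; exists f => // x y _ _; exact: finj.
exact: (inj_card_le g).
Qed.

(* Zorn on the subsets of the product of the members of [P] that are          *)
(* injective in each coordinate: a maximal one covers some coordinate.        *)
Lemma cardinal_has_min (P : set cardinal) :
  P !=set0 -> exists k, P k /\ lbound P k.
Proof.
move=> [k0 Pk0]; pose T := forall k : cardinal, P k -> k.
pose coinj (M : set T) := forall t u k (Pk : P k),
  M t -> M u -> t k Pk = u k Pk -> t = u.
have [F FP Ftot|M [Minj Mmax]] := @Zorn_bigcup T coinj.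
  move=> t u k Pk [A FA At] [B FB Bu].
  have [AB|BA] := Ftot _ _ FA FB.
    by apply: (FP _ FB) => //; exact: AB.
  by apply: (FP _ FA) => //; exact: BA.
have [k [Pk kM]] : exists k (Pk : P k), forall a : k, exists2 t, M t & t k Pk = a.
  apply: contrapT => noM.
  have miss k (Pk : P k) : exists a : k, forall t, M t -> t k Pk <> a.
    apply: contrapT => h; apply: noM; exists k, Pk => a.
    apply: contrapT => h'; apply: h; exists a => t Mt e.
    by apply: h'; exists t.
  pose t0 : T := fun k Pk => sval (cid (miss k Pk)).
  have t0P t k (Pk : P k) : M t -> t k Pk <> t0 k Pk.
    by move=> Mt; rewrite /t0; case: (cid _) => a /= ; exact.
  apply: (Mmax (M `|` [set t0])).
    split; first by move=> t Mt; left.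
    by move=> /(_ t0 (or_intror erefl)) Mt0; exact: (t0P t0 k0 Pk0).
  move=> t u k Pk [Mt|->] [Mu|->] // e; first exact: Minj e.
    by case: (t0P t k Pk Mt).
  by case: (t0P u k Pk Mu).
exists k; split=> // m Pm.
have sel (a : k) : exists t, M t /\ t k Pk = a by have [t] := kM a; exists t.
pose g a := sval (cid (sel a)).
have gP a : M (g a) /\ g a k Pk = a := svalP (cid (sel a)).
apply: (@inj_cardinal_le k m (fun a => g a m Pm)) => a b gab.
have [[Ma <-] [Mb <-]] := (gP a, gP b).
by rewrite (Minj _ _ _ _ Ma Mb gab).
Qed.

Lemma cardinal_le_total : total (<=%O : rel cardinal).
Proof.
move=> k m; have [|n [[->|->] lbn]] := @cardinal_has_min [set k; m].
- by exists k; left.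
- by rewrite (lbn m) //; right.
- by rewrite (lbn k) ?orbT //; left.
Qed.

HB.instance Definition _ :=
  Order.POrder_isTotal.Build cardinal_display cardinal cardinal_le_total.

(* The default is only returned when no cardinal satisfies [P]. *)
Definition cardinal_min (P : set cardinal) : cardinal :=
  xget (card_of void) (P `&` lbound P).

Lemma cardinal_minP (P : set cardinal) :
  P !=set0 -> P (cardinal_min P) /\ lbound P (cardinal_min P).
Proof.
move=> /cardinal_has_min[k Pk]; rewrite /cardinal_min.
by case: xgetP => [m _ //|/(_ k)].
Qed.

Definition aleph0 : cardinal := card_of nat.

Definition cardinal2 : cardinal := card_of bool.

Definition csucc (k : cardinal) : cardinal := cardinal_min [set m | k < m].

Definition limit_cardinal (k : cardinal) : Prop :=
  aleph0 <= k /\ forall m : cardinal, m < k -> csucc m < k.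

(* [P_t(A) = {x `<=` A : |x| < t}] *)
Definition Psub (S : Type) (t : cardinal) (A : S -> Prop) : set (S -> Prop) :=
  [set x : S -> Prop | (x : set S) `<=` A /\ card_of_set x < t].

Definition covering (r1 r2 r3 r4 : cardinal) (X : (r1 -> Prop) -> Prop) : Prop :=
  (X : set (r1 -> Prop)) `<=` Psub r2 [set: r1] /\
  forall b : r1 -> Prop, Psub r3 [set: r1] b ->
    exists2 Q : (r1 -> Prop) -> Prop,
      Psub r4 X Q & (b : set r1) `<=` \bigcup_(x in Q) x.

(* Meaningful when [r2 <= csucc r1], [aleph0 <= r3 <= csucc r2],              *)
(* [cardinal2 <= r4 <= r3], and a covering family exists. The last condition  *)
(* is automatic for [r2 = r3]: take all of [Psub r2 [set: r1]].               *)
Definition cov (r1 r2 r3 r4 : cardinal) : cardinal :=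
  cardinal_min
    [set k | exists2 X, @covering r1 r2 r3 r4 X & card_of_set X = k].

Definition revision_cardinal (lambda chi : cardinal) : Prop :=
  [/\ aleph0 <= chi, chi <= lambda &
    exists sigma : cardinal,
      [/\ cardinal2 <= sigma, sigma < chi & cov lambda chi chi sigma <= lambda]].

Definition ucov (sigma lambda : cardinal) : cardinal :=
  cov lambda sigma sigma aleph0.

(* Main.v *)
Require Import Defs.
From mathcomp Require Import all_boot all_order.
From mathcomp Require Import boolp classical_sets functions cardinality.
From mathcomp Require wochoice.
Import Order.TTheory.
Local Open Scope order_scope.

(** Write chi^+ for [csucc chi], and let sigma < chi be infinite.

    For the upper bound, take a family that witnesses u(chi^+, lambda): each of
    its members x has size at most chi, so a copy on x of a family that
    witnesses u(sigma, chi) covers the small subsets of x.  The members of all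
    these copies form a cover for u(sigma, lambda) ([ucov_le_max]); their
    number is at most a product of two cardinals, which is the maximum because
    u(sigma, chi) > sigma is infinite ([lt_ucov]).  Conversely
    u(sigma, chi) <= u(sigma, lambda), since covers can be pulled back along
    an injection of chi into lambda ([cov_mono1]).

    The revision hypothesis gives u(chi^+, lambda) <= u(sigma, lambda), as
    follows.
    There is a family Y of at most lambda sets of size at most chi such that
    every set of size at most chi is covered by fewer than chi members of Y.
    The bound can be made uniform: some tau < chi works for all sets at once
    ([covering_uniform]).  Otherwise choose a bad set for each term of a
    family of cardinals, cofinal in chi and indexed by chi; the union of these
    sets still has size at most chi, hence is covered by some mu < chi members
    of Y, which contradicts the choice of a bad set for a cardinal above mu
    (there is one in the family because chi is a limit).  Now let sigma >= tau
    and index Y by lambda.  A set of size at most chi is covered by fewer than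
    sigma members of Y, that is, by the members with index in some subset of
    lambda of size less than sigma; a cover for u(sigma, lambda) captures this
    subset by finitely many of its members x.  So the unions of the Y_i for i
    in x form a cover for u(chi^+, lambda)
    ([ucov_csucc_le]).  Hence sigma_0 = max(aleph_0, tau).

    The cardinal arithmetic behind this is k * k = k for infinite k
    ([pairing_exists]), and the cofinal family comes from a well-ordering of
    chi ([cofinal_cardinals]). *)

Set Implicit Arguments.
Unset Strict Implicit.
Unset Printing Implicit Defensive.

(** * Comparing cardinalities *)

Definition inj_on (S T : Type) (A : S -> Prop) (f : S -> T) : Prop :=
  forall x y, A x -> A y -> f x = f y -> x = y.

Lemma card_of_leP (A B : Type) :
  card_of A <= card_of B <-> exists f : A -> B, injective f.
Proof.
have -> : (card_of A <= card_of B) = ([set: A] #<= [set: B])%card.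
  have eA := (card_of_eqP _ _).1 (carrierK (card_of A)).
  have eB := (card_of_eqP _ _).1 (carrierK (card_of B)).
  by rewrite -(card_le_eql eA) -(card_le_eqr eB).
split=> [/card_leP/injfunPex[f _ finj]|[f finj]].
  exists (fun x => set_val (f (exist _ x (in_setT x)))) => x y /val_inj fxy.
  by have /(congr1 sval)/= := finj _ _ (in_setT _) (in_setT _) fxy.
have [g] : $|{injfun [set: A] >-> [set: B]}|.
  by apply/injfunPex; exists f => // x y _ _; exact: finj.
exact: (inj_card_le g).
Qed.

Lemma sval_inj (S : Type) (A : S -> Prop) : injective (@sval S A).
Proof.
by move=> [x Ax] [y Ay] /= xy; subst y; congr exist; exact: Prop_irrelevance.
Qed.

Lemma card_of_set_le_image (S T : Type) (A : S -> Prop) (B : T -> Prop)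
    (F : S -> T) :
  (forall y, B y -> exists2 x, A x & F x = y) ->
  card_of_set B <= card_of_set A.
Proof.
move=> surj; apply/card_of_leP.
pose g (y : {y | B y}) := cid2 (surj _ (svalP y)).
exists (fun y => exist A (s2val (g y)) (s2valP (g y))) => y z /(congr1 sval)/= e.
by apply: sval_inj; rewrite -[LHS](s2valP' (g y)) e (s2valP' (g z)).
Qed.

Lemma card_of_set_le_inj (S T : Type) (A : S -> Prop) (B : T -> Prop)
    (f : S -> T) :
  (forall x, A x -> B (f x)) -> inj_on A f -> card_of_set A <= card_of_set B.
Proof.
move=> fAB finj; apply/card_of_leP.
exists (fun x : {x | A x} => exist B (f (sval x)) (fAB _ (svalP x))).
move=> x y /(congr1 sval)/= e; apply: sval_inj.
by apply: finj e; exact: svalP.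
Qed.

Lemma card_of_set_sub (S : Type) (A B : S -> Prop) :
  (forall x, A x -> B x) -> card_of_set A <= card_of_set B.
Proof. by move=> AB; apply: (@card_of_set_le_inj _ _ _ _ id). Qed.

Lemma card_of_setT (S : Type) : card_of_set [set: S]%classic = card_of S.
Proof.
apply/eqP; rewrite eq_le; apply/andP; split; apply/card_of_leP.
  by exists sval; exact: sval_inj.
by exists (fun x => exist _ x I) => x y /(congr1 sval).
Qed.

(** Functions defined on all of [S] are easier to choose uniformly in [A] than
    functions on the subtype; the point [t0] supplies their values off [A]. *)
Lemma card_of_set_leP (S T : Type) (A : S -> Prop) (t0 : T) :
  card_of_set A <= card_of T <-> exists f : S -> T, inj_on A f.
Proof.
split=> [/card_of_leP[g ginj]|[f finj]].
  exists (fun x => if pselect (A x) is left Ax then g (exist _ x Ax) else t0).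
  move=> x y Ax Ay; case: pselect => // Ax'; case: pselect => // Ay'.
  by move=> /ginj/(congr1 sval).
by rewrite -(card_of_setT T); exact: card_of_set_le_inj finj.
Qed.

Lemma card_of_set1 (S : Type) (a : S) : card_of_set (fun x => x = a) < cardinal2.
Proof.
rewrite ltNge; apply/negP => /card_of_leP[f finj].
have fE b : sval (f b) = a by exact: (svalP (f b)).
by have : true = false by apply: finj; apply: sval_inj; rewrite !fE.
Qed.

Lemma card2_le_aleph0 : cardinal2 <= aleph0.
Proof. by apply/card_of_leP; exists nat_of_bool; case; case. Qed.

Lemma card_lt_aleph0 (S : Type) (A : S -> Prop) :
  card_of_set A < aleph0 <-> finite_set (A : set S).
Proof.
rewrite ltNge; split=> [/negP nA|/finite_setPn nA].
  apply/finite_setPn => /card_leP/injfunPex[f _ finj]; apply: nA.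
  apply/card_of_leP.
  exists (fun n => exist A (set_val (f (exist _ n (in_setT n))))
                           (set_mem (valP _))) => m n /(congr1 sval)/= /val_inj.
  move=> /(finj _ _ (in_setT _) (in_setT _)).
  by move/(congr1 sval).
apply/negP => /card_of_leP[f finj]; apply: nA.
have [g] : $|{injfun [set: nat] >-> (A : set S)}|.
  apply/injfunPex; exists (fun n => sval (f n)) => [n _|m n _ _ e].
    exact: (svalP (f n)).
  by apply: finj; exact: sval_inj.
exact: (inj_card_le g).
Qed.

Lemma finite_bigcup_lt (I T : Type) (D : I -> Prop) (F : I -> T -> Prop) :
  card_of_set D < aleph0 -> (forall i, D i -> card_of_set (F i) < aleph0) ->
  card_of_set (fun x => exists2 i, D i & F i x) < aleph0.
Proof.
move=> /card_lt_aleph0 finD finF; apply/card_lt_aleph0.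
by apply: (bigcup_finite finD) => i /finF/card_lt_aleph0.
Qed.

(** Cantor's diagonal argument. *)
Lemma lt_card_of_powerset (k : cardinal) : k < card_of (k -> Prop).
Proof.
rewrite -{1}(carrierK k) ltNge; apply/negP => /card_of_leP[f finj].
pose D a := exists2 p : k -> Prop, f p = a & ~ p a.
have [[p /finj-> nD]|nD] := pselect (D (f D)); first by apply: (nD); exists D.
by apply: (nD); exists D.
Qed.

(** Cantor's theorem makes the minimum that defines [csucc] a genuine one. *)
Lemma lt_csucc (k m : cardinal) : (m < csucc k) = (m <= k).
Proof.
have [|ks lbs] := @cardinal_minP [set m | k < m]%classic.
  by exists (card_of (k -> Prop)); exact: lt_card_of_powerset.
rewrite [in LHS]/csucc; apply/idP/idP => [ms|mk]; last exact: le_lt_trans ks.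
by rewrite leNgt; apply/negP => /lbs; rewrite leNgt ms.
Qed.


(** * The square of an infinite cardinal *)

(** [A] squared injects into [A] by [f], whose values off [A] are junk. *)
Definition pairing_on (T : Type) (A : T -> Prop) (f : T -> T -> T) : Prop :=
  (forall x y, A x -> A y -> A (f x y)) /\
  forall x y x' y', A x -> A y -> A x' -> A y' ->
    f x y = f x' y' -> x = x' /\ y = y'.

Definition pairing_ext (T : Type) (A : T -> Prop) (f : T -> T -> T)
    (B : T -> Prop) (g : T -> T -> T) : Prop :=
  (forall x, A x -> B x) /\ forall x y, A x -> A y -> f x y = g x y.

Lemma pairing_on_infinite (T : Type) (i : nat -> T) : injective i ->
  exists f, pairing_on (fun x => exists n, i n = x) f.
Proof.
move=> iinj.
have [g gP] : exists g : T -> nat, forall n, g (i n) = n.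
  have /choice[g gP] : forall x, exists n, forall m, i m = x -> m = n.
    move=> x; have [[n <-]|nx] := pselect (exists n, i n = x).
      by exists n => m /iinj.
    by exists 0%N => m mx; case: nx; exists m.
  by exists g => n; rewrite -(gP _ n erefl).
exists (fun x y => i (pickle (g x, g y))).
split=> [x y _ _|_ _ _ _ [a <-] [b <-] [c <-] [d <-]]; first by eexists.
by rewrite !gP => /iinj/(pcan_inj (@pickleK (nat * nat)%type))[-> ->].
Qed.

(** Zorn's lemma for extension of pairings.  Extension is only a preorder,
    because of the junk values, so maximality is stated on the domains. *)
Lemma pairing_maximal (T : Type) (A0 : T -> Prop) (f0 : T -> T -> T) :
  pairing_on A0 f0 ->
  exists A f, [/\ pairing_on A f, forall x, A0 x -> A x &
    forall B g, pairing_on B g -> pairing_ext A f B g -> forall x, B x -> A x].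
Proof.
move=> f0P.
pose good (Af : (T -> Prop) * (T -> T -> T)) :=
  pairing_on Af.1 Af.2 /\ forall x, A0 x -> Af.1 x.
pose P := {Af | good Af}.
pose dom (u : P) := (sval u).1; pose op (u : P) := (sval u).2.
pose ext (u v : P) : bool := `[< pairing_ext (dom u) (op u) (dom v) (op v) >].
have goodP (u : P) : good (sval u) by exact: svalP.
pose base : P := exist good (A0, f0) (conj f0P (fun _ => id)).
have [|||[[A f] [fP A0A]] Amax] := @ZL_preorder P base ext; last first.
- exists A, f; split=> // B g gP AB.
  have Bgood : good (B, g) by split=> // x /A0A; exact: AB.1.
  by have /asboolP[] := Amax (exist good _ Bgood) (asboolT AB).
- move=> F Ftot.
  have [[u0 Fu0]|F0] := pselect (exists u, F u); last first.
    by exists base => u Fu; case: F0; exists u.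
  have ub2 u v : F u -> F v -> exists2 w, F w & ext u w /\ ext v w.
    have extxx w : ext w w by apply/asboolP.
    by move=> Fu Fv; have [uv|vu] := Ftot u v Fu Fv; [exists v|exists u].
  have ub2P u v x y : F u -> F v -> dom u x -> dom v y ->
      exists2 w, F w & dom w x /\ dom w y.
    move=> Fu Fv ux vy; have [w Fw [/asboolP[uw _] /asboolP[vw _]]] := ub2 u v Fu Fv.
    by exists w => //; split; [exact: uw|exact: vw].
  pose B x := exists2 u, F u & dom u x.
  have /choice[g gE] : forall xy : T * T, exists z, forall u, F u ->
      dom u xy.1 -> dom u xy.2 -> op u xy.1 xy.2 = z.
    move=> [x y] /=.
    have [[u [Fu ux uy]]|nu] := pselect (exists u, [/\ F u, dom u x & dom u y]).
      exists (op u x y) => v Fv vx vy.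
      by have [/asboolP[_ ->]|/asboolP[_ ->]] := Ftot u v Fu Fv.
    by exists x => u Fu ux uy; case: nu; exists u.
  have Bgood : good (B, fun x y => g (x, y)).
    split=> /= [|x A0x]; last by exists u0 => //; case: (goodP u0) => _; exact.
    split=> [x y [u Fu ux] [v Fv vy]|x y x' y' [u Fu ux] [v Fv vy] [u' Fu' ux'] [v' Fv' vy']].
      have [w Fw [wx wy]] := ub2P u v x y Fu Fv ux vy.
      by exists w => //; rewrite -(gE (x, y) w) //; case: (goodP w) => -[+ _] _; exact.
    have [w Fw [wx wy]] := ub2P u v x y Fu Fv ux vy.
    have [w' Fw' [wx' wy']] := ub2P u' v' x' y' Fu' Fv' ux' vy'.
    have [z Fz [/asboolP[wz _] /asboolP[wz' _]]] := ub2 w w' Fw Fw'.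
    rewrite -(gE (x, y) z) -?(gE (x', y') z) //=; try by [exact: wz|exact: wz'].
    by case: (goodP z) => -[_ zinj] _; apply: zinj; by [exact: wz|exact: wz'].
  exists (exist good _ Bgood) => u Fu; apply/asboolP.
  split=> [x ux|x y ux uy]; first by exists u.
  exact: (gE (x, y)).
- move=> v u w /asboolP[uv fuv] /asboolP[vw fvw]; apply/asboolP.
  split=> [x /uv/vw //|x y ux uy].
  by rewrite fuv // fvw //; exact: uv.
- by move=> u; apply/asboolP.
Qed.

(** If a copy [h A] of [A] fits outside [A], then [B = A + h A] injects into [A]
    by [q], which tags a point by the side it comes from, with tags [c].  Hence all the pairs
    of [B] that are not pairs of [A] can be sent injectively into the new part
    [h A], by [h (f (q x) (q y))]. *)
Lemma pairing_extend (T : Type) (A : T -> Prop) (f : T -> T -> T) (c : bool -> T) :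
  pairing_on A f -> (forall b, A (c b)) -> injective c ->
  card_of_set A <= card_of_set (fun x => ~ A x) ->
  exists B g, [/\ pairing_on B g, pairing_ext A f B g & exists2 x, B x & ~ A x].
Proof.
move=> [fA finj] cA cinj leA.
have [h hinj hA] : exists2 h : T -> T, inj_on A h & forall x, A x -> ~ A (h x).
  have [h0 h0inj] := (card_of_leP _ _).1 leA.
  exists (fun x => if pselect (A x) is left Ax then sval (h0 (exist _ x Ax)) else x).
    move=> x y Ax Ay; case: pselect => // Ax'; case: pselect => // Ay'.
    by move=> /sval_inj/h0inj/(congr1 sval).
  by move=> x Ax; case: pselect => // Ax'; exact: (svalP (h0 _)).
pose B x := A x \/ exists2 y, A y & h y = x.
have /choice[d dP] : forall x, exists p : bool * T, B x ->
    A p.2 /\ x = if p.1 then h p.2 else p.2.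
  move=> x; have [[Ax|[y Ay yx]]|nB] := pselect (B x).
  - by exists (false, x).
  - by exists (true, y).
  - by exists (true, x).
(* [d x] is the side of [x] together with the point of [A] it comes from. *)
pose q x := f (c (d x).1) (d x).2.
have qA x : B x -> A (q x) by move=> /dP[dA _]; exact: fA.
have qinj : inj_on B q.
  move=> x y /dP[dx xE] /dP[dy yE].
  by move=> /finj[]// /cinj e1 e2; rewrite xE yE e1 e2.
have qqA x y : B x -> B y -> A (f (q x) (q y)) by move=> /qA ? /qA; exact: fA.
pose g x y := if pselect (A x /\ A y) is left _ then f x y else h (f (q x) (q y)).
exists B, g; split; last first.
- by exists (h (c true)); [right; exists (c true)|exact: hA].
- split=> [x Ax|x y Ax Ay]; first by left.
  by rewrite /g; case: pselect => // -[].
split=> [x y Bx By|x y x' y' Bx By Bx' By'].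
  rewrite /g; case: pselect => [[Ax Ay]|_]; first by left; exact: fA.
  by right; exists (f (q x) (q y)) => //; exact: qqA.
rewrite /g; case: pselect => [[Ax Ay]|nA]; case: pselect => [[Ax' Ay']|nA'].
- exact: finj.
- by move=> e; case: (hA (f (q x') (q y'))); rewrite -?e; [exact: qqA|exact: fA].
- by move=> e; case: (hA (f (q x) (q y))); rewrite ?e; [exact: qqA|exact: fA].
- move=> /hinj => /(_ (qqA _ _ Bx By) (qqA _ _ Bx' By')).
  by move=> /finj[]; try exact: qA; move=> /qinj-> // /qinj->.
Qed.

(** Hessenberg's theorem.  By [pairing_extend], the complement of the domain
    [A] of a maximal pairing is smaller than [A]; then the whole type injects
    into [A], again by tagging, and the pairing of [A] transfers to it. *)
Lemma pairing_exists (T : Type) : aleph0 <= card_of T ->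
  exists f : T -> T -> T,
    forall x y x' y', f x y = f x' y' -> x = x' /\ y = y'.
Proof.
move=> /card_of_leP[i iinj].
have [f0 f0P] := pairing_on_infinite iinj.
have [A [f [fP iA Amax]]] := pairing_maximal f0P.
pose c (b : bool) := i b.
have cA b : A (c b) by apply: iA; exists b.
have cinj : injective c by move=> b b' /iinj; case: b b' => [] [].
have [leA|ltA] := leP (card_of_set A) (card_of_set (fun x => ~ A x)).
  have [B [g [gP AB [x Bx nAx]]]] := pairing_extend fP cA cinj leA.
  by case: nAx; exact: Amax gP AB x Bx.
have [k kinj] := (card_of_leP _ _).1 (ltW ltA).
case: fP => fA finj.
pose q x := match pselect (A x) with
  | left _ => f (c true) x
  | right nA => f (c false) (sval (k (exist _ x nA))) end.
have qA x : A (q x).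
  by rewrite /q; case: pselect => [Ax|nA]; apply: fA => //; exact: svalP.
have qinj : injective q.
  move=> x y; rewrite /q; case: pselect => Ax; case: pselect => Ay;
    move=> /finj[]//; try (exact: svalP); try by move=> /cinj.
  by move=> _ /sval_inj/kinj/(congr1 sval).
exists (fun x y => f (q x) (q y)) => x y x' y'.
by move=> /finj[]// /qinj -> /qinj ->.
Qed.

(** A point of the union is coded by an index and its place in that member. *)
Lemma card_of_bigcup_le (I S : Type) (D : I -> Prop) (F : I -> S -> Prop)
    (k : cardinal) :
  aleph0 <= k -> card_of_set D <= k -> (forall i, D i -> card_of_set (F i) <= k) ->
  card_of_set (fun x => exists2 i, D i & F i x) <= k.
Proof.
rewrite -(carrierK k) => k_inf.
have [i0 _] := (card_of_leP _ _).1 k_inf.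
have [p pinj] := pairing_exists k_inf.
move=> /(card_of_set_leP _ (i0 0%N))[d dinj] leF.
have /choice[e eP] : forall i, exists e : S -> k, D i -> inj_on (F i) e.
  move=> i; have [Di|nD] := pselect (D i); last by exists (fun=> i0 0%N).
  by have /(card_of_set_leP _ (i0 0%N))[e einj] := leF i Di; exists e.
pose s (x : {x | exists2 i, D i & F i x}) := cid2 (svalP x).
apply/card_of_leP; exists (fun x => p (d (s2val (s x))) (e (s2val (s x)) (sval x))).
move=> x y /pinj[/(dinj _ _ (s2valP (s x)) (s2valP (s y))) si].
rewrite si => /(eP _ (s2valP (s y))) exy; apply: sval_inj; apply: exy.
  by rewrite -si; exact: (s2valP' (s x)).
exact: (s2valP' (s y)).
Qed.

Lemma card_of_setX_le (I J S : Type) (D : I -> Prop) (E : J -> Prop)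
    (F : I -> J -> S) (k : cardinal) :
  aleph0 <= k -> card_of_set D <= k -> card_of_set E <= k ->
  card_of_set (fun x => exists2 i, D i & exists2 j, E j & F i j = x) <= k.
Proof.
move=> k_inf Dk Ek; apply: card_of_bigcup_le => // i Di.
apply: le_trans Ek; apply: (@card_of_set_le_image _ _ _ _ (F i)).
by move=> _ [j Ej <-]; exists j.
Qed.

(** * Cofinal families of cardinals *)

Lemma well_ordering (T : Type) : exists R : T -> T -> Prop,
  [/\ forall x y, R x y \/ R y x, forall x y, R x y -> R y x -> x = y &
    forall P : T -> Prop, (exists x, P x) -> exists2 x, P x & forall y, P y -> R x y].
Proof.
elim/Peq : T => T; have [R Rwo] := wochoice.well_ordering_principle T.
have Rmin (P : T -> Prop) : (exists x, P x) ->
    exists2 x, P x & forall y, P y -> R x y.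
  move=> [x Px]; have [|z [[/asboolP Pz zP] _]] := Rwo (fun x => `[< P x >]).
    by exists x; apply/asboolP.
  by exists z => // y Py; apply: zP; apply/asboolP.
exists R; split=> // x y.
  have [|z [->|->] zP] := Rmin (fun z => z = x \/ z = y); first by exists x; left.
  - by left; apply: zP; right.
  - by right; apply: zP; left.
move=> xy yx; have [|z [_ zu]] := Rwo [pred z | (z == x) || (z == y)].
  by exists x; rewrite inE eqxx.
have Rxx w : R w w by have [|_ -> /(_ w)] := Rmin (fun z => z = w); [exists w|exact].
rewrite -(zu x) ?(zu y) //; split; rewrite ?inE ?eqxx ?orbT // => w.
  by rewrite inE => /orP[] /eqP ->.
by rewrite inE => /orP[] /eqP ->.
Qed.

Lemma card_of_setU1_le (S : Type) (A : S -> Prop) (a : S) (k : cardinal) :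
  aleph0 <= k -> card_of_set A <= k -> card_of_set (fun x => A x \/ x = a) <= k.
Proof.
move=> k_inf Ak.
pose F (b : bool) x := if b then A x else x = a.
have le2k : cardinal2 <= k := le_trans card2_le_aleph0 k_inf.
apply: (@le_trans _ _ (card_of_set (fun x => exists2 b, True & F b x))).
  by apply: card_of_set_sub => x [Ax|xa]; [exists true|exists false].
apply: card_of_bigcup_le => //; first by rewrite (@card_of_setT bool).
by case=> // _; exact: ltW (lt_le_trans (card_of_set1 a) le2k).
Qed.

(** The type of all cardinals below [k] is too large to have a cardinality, so
    a cofinal family of them has to be indexed by [k] itself.  Well-order [k]
    and use the cardinalities of its initial segments, when they are below
    [k].  If they were all below some [t < k], the points [W] with such a
    segment would make up only [m = max(t, aleph_0)] points: a subset of [W] of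
    size [m] lies in no segment, hence is cofinal in [W], and [W] is a union of
    [m] segments of size at most [m].  But [W] has size [k]: it is everything,
    or it contains the segment of the first point outside it. *)
Lemma cofinal_cardinals (k : cardinal) : aleph0 < k ->
  exists h : k -> cardinal,
    (forall x, h x < k) /\ forall t, t < k -> exists x, t <= h x.
Proof.
move=> k_unc; have [R [Rtot Ranti Rmin]] := well_ordering k.
pose seg x y := ~ R x y.
have segle x y : R y x -> seg x y \/ y = x.
  by move=> yx; have [xy|] := pselect (R x y); [right; exact: Ranti|left].
pose h x := if card_of_set (seg x) < k then card_of_set (seg x) else aleph0.
(* The order type of [R] need not be minimal, so a segment may have size [k];
   any cardinal below [k] can replace it. *)
exists h; split=> [x|t tk]; first by rewrite /h; case: ifP.
apply: contrapT => nh.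
have ht x : h x < t by rewrite ltNge; apply/negP => th; apply: nh; exists x.
pose W x := card_of_set (seg x) < k.
have kW : k <= card_of_set W.
  have [[x0 nWx0]|Wall] := pselect (exists x, ~ W x); last first.
    rewrite -{1}(carrierK k) -(card_of_setT k); apply: card_of_set_sub => x _.
    by apply: contrapT => nW; apply: Wall; exists x.
  have [|x nWx xmin] := Rmin (fun x => ~ W x); first by exists x0.
  apply: (@le_trans _ _ (card_of_set (seg x))); first by rewrite leNgt; exact/negP.
  by apply: card_of_set_sub => y yx; apply: contrapT => /xmin.
pose m := Order.max t aleph0.
have mk : m < k by rewrite gt_max tk.
have [s sinj] : exists s : m -> {x | W x}, injective s.
  by apply/card_of_leP; rewrite carrierK; exact: le_trans (ltW mk) kW.
have m_inf : aleph0 <= m by rewrite le_max lexx orbT.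
have hW x : W x -> card_of_set (seg x) < t by rewrite /W => Wx; have := ht x; rewrite /h Wx.
have : card_of_set W <= m.
  apply: (@le_trans _ _
      (card_of_set (fun x => exists2 a : m, True & R x (sval (s a))))).
    apply: card_of_set_sub => w Ww; apply: contrapT => nw.
    suff : m <= card_of_set (seg w).
      by rewrite leNgt (lt_le_trans (hW _ Ww)) // le_max lexx.
    rewrite -{1}(carrierK m) -(card_of_setT m).
    apply: (@card_of_set_le_inj _ _ _ _ (fun a => sval (s a))).
      by move=> a _ wa; apply: nw; exists a.
    by move=> a b _ _ /sval_inj/sinj.
  apply: card_of_bigcup_le => // [|a _]; first by rewrite (card_of_setT m) carrierK.
  apply: (@le_trans _ _ (card_of_set (fun x => seg (sval (s a)) x \/ x = sval (s a)))).
    by apply: card_of_set_sub => x; exact: segle.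
  apply: card_of_setU1_le => //; apply: ltW; apply: lt_le_trans (hW _ (svalP (s a))) _.
  by rewrite le_max lexx.
by rewrite leNgt (lt_le_trans mk kW).
Qed.

(** * Covering numbers *)

Lemma cov_le (r1 r2 r3 r4 : cardinal) (X : (r1 -> Prop) -> Prop) :
  covering r2 r3 r4 X -> cov r1 r2 r3 r4 <= card_of_set X.
Proof.
move=> Xcov; pose P := [set k | exists2 X, @covering r1 r2 r3 r4 X & card_of_set X = k]%classic.
by have [|_ lb] := @cardinal_minP P; [exists (card_of_set X), X|apply: lb; exists X].
Qed.

Lemma card_of_set1_lt (S : Type) (a : S) (k : cardinal) :
  cardinal2 <= k -> card_of_set (fun x => x = a) < k.
Proof. exact: lt_le_trans (card_of_set1 a). Qed.

(** The family of all sets of size below [r2] is a cover; each small set is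
    covered by the family consisting of itself. *)
Lemma cov_attained (r1 r2 r4 : cardinal) : cardinal2 <= r4 ->
  exists2 X, @covering r1 r2 r2 r4 X & card_of_set X = cov r1 r2 r2 r4.
Proof.
move=> r4_2; pose P := [set k | exists2 X, @covering r1 r2 r2 r4 X & card_of_set X = k]%classic.
have [|//] := @cardinal_minP P.
exists (card_of_set (Psub r2 [set: r1]%classic)), (Psub r2 [set: r1]%classic) => //.
split=> // b br2; exists (fun x => x = b); last by move=> a ba; exists b.
by split=> [_ ->//|]; exact: card_of_set1_lt.
Qed.

(** Pull covers back along an injection. *)
Lemma cov_mono1 (k l s t : cardinal) : cardinal2 <= t -> k <= l ->
  cov k s s t <= cov l s s t.
Proof.
move=> t2; rewrite -{1}(carrierK k) -{1}(carrierK l) => /card_of_leP[i iinj].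
have [X [Xs Xcov] <-] := @cov_attained l s t t2.
pose pull (x : l -> Prop) a := x (i a).
pose Z z := exists2 x, X x & pull x = z.
have leZ : card_of_set Z <= card_of_set X by exact: (@card_of_set_le_image _ _ _ _ pull).
apply: le_trans leZ; apply: cov_le; split=> [_ [x Xx <-]|b [_ bs]].
  split=> //; apply: le_lt_trans (Xs x Xx).2.
  by apply: (@card_of_set_le_inj _ _ _ _ i) => // a a' _ _ /iinj.
have [|Q [QX Qt] Qcov] := Xcov (fun v => exists2 a, b a & i a = v).
  split=> //; apply: le_lt_trans bs; exact: (@card_of_set_le_image _ _ _ _ i).
exists (fun z => exists2 x, Q x & pull x = z).
  split=> [_ [x /QX Xx <-]|]; first by exists x.
  by apply: le_lt_trans Qt; exact: (@card_of_set_le_image _ _ _ _ pull).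
move=> a ba; have [|x Qx xa] := Qcov (i a); first by exists a.
by exists (pull x) => //; exists x.
Qed.

(** A cover contains every point, and [s] sets of size below [s] contain only
    [s] points. *)
Lemma lt_ucov (s k : cardinal) : aleph0 <= s -> s < k -> s < ucov s k.
Proof.
rewrite /ucov => s_inf sk; have [X [Xs Xcov] <-] := @cov_attained k s _ card2_le_aleph0.
rewrite ltNge; apply/negP => Xle; move: sk; rewrite ltNge => /negP[].
have : card_of_set (fun a => exists2 x, X x & x a) <= s.
  by apply: card_of_bigcup_le => // x /Xs[_] /ltW.
apply: le_trans; rewrite -{1}(carrierK k) -(card_of_setT k).
apply: card_of_set_sub => a _.
have [|Q [QX _] Qcov] := Xcov (fun x => x = a).
  by split=> //; apply: card_of_set1_lt; exact: le_trans card2_le_aleph0 s_inf.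
by have [x /QX Xx xa] := Qcov a erefl; exists x.
Qed.

(** Refine each member [x] of a cover for [ucov (csucc c) l] by the preimages,
    under an injection [j x] of [x] into [c], of the members of a cover for
    [ucov s c]. *)
Lemma ucov_le_max (s c l : cardinal) : aleph0 <= s -> s < c ->
  ucov s l <= Order.max (ucov s c) (ucov (csucc c) l).
Proof.
move=> s_inf sc; set m := Order.max _ _.
have m_inf : aleph0 <= m.
  by rewrite le_max (le_trans s_inf (ltW (lt_ucov s_inf sc))).
have [Y [Ys Ycov] Ycard] := @cov_attained c s _ card2_le_aleph0.
have [X [Xs Xcov] Xcard] := @cov_attained l (csucc c) _ card2_le_aleph0.
have [c0 _] : exists f : nat -> c, injective f.
  by apply/card_of_leP; rewrite carrierK; exact: le_trans s_inf (ltW sc).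
have /choice[j jP] : forall x : l -> Prop, exists j : l -> c, X x -> inj_on x j.
  move=> x; have [Xx|nX] := pselect (X x); last by exists (fun=> c0 0%N).
  have := (Xs x Xx).2; rewrite lt_csucc -{1}(carrierK c).
  by move=> /(card_of_set_leP _ (c0 0%N))[j jinj]; exists j.
pose F (x : l -> Prop) (y : c -> Prop) a := x a /\ y (j x a).
pose Z z := exists2 x, X x & exists2 y, Y y & F x y = z.
have Zm : card_of_set Z <= m.
  apply: card_of_setX_le => //; first by rewrite Xcard le_max lexx orbT.
  by rewrite Ycard le_max lexx.
apply: le_trans Zm; apply: cov_le; split=> [_ [x Xx [y Yy <-]]|b [_ bs]].
  split=> //; apply: le_lt_trans (Ys y Yy).2.
  apply: (@card_of_set_le_inj _ _ _ _ (j x)) => [a []//|a a' [xa _] [xa' _]].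
  exact: (jP x Xx).
have [|Q [QX Qfin] Qcov] := Xcov b.
  by split=> //; rewrite lt_csucc; exact: ltW (lt_trans bs sc).
have /choice[P PP] : forall q, exists P : (c -> Prop) -> Prop,
    Psub aleph0 Y P /\ forall a, b a -> exists2 y, P y & y (j q a).
  move=> q; have [|P PY Pcov] := Ycov (fun v => exists2 a, b a & j q a = v).
    by split=> //; apply: le_lt_trans bs; exact: (@card_of_set_le_image _ _ _ _ (j q)).
  by exists P; split=> // a ba; apply: Pcov; exists a.
exists (fun z => exists2 q, Q q & exists2 y, P q y & F q y = z).
  split=> [_ [q /QX Xq [y Py <-]]|].
    by exists q => //; exists y => //; exact: (PP q).1.1.
  apply: finite_bigcup_lt => // q _; apply: le_lt_trans (PP q).1.2.
  exact: (@card_of_set_le_image _ _ _ _ (F q)).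
move=> a ba; have [q Qq qa] := Qcov a ba; have [y Py ya] := (PP q).2 a ba.
by exists (F q y) => //; exists q => //; exists y.
Qed.

(** The injection [j] indexes [Y] by points of [l], so that a small subfamily of
    [Y] becomes a small subset of [l].  A cover for [ucov s l] captures such
    subsets, and [U] turns each of its members into the union of the members
    of [Y] that it indexes. *)
Lemma ucov_csucc_le (s t c l : cardinal) (Y : (l -> Prop) -> Prop) :
  aleph0 <= s -> s <= c -> t <= s -> c <= l ->
  covering (csucc c) (csucc c) t Y -> card_of_set Y <= l ->
  ucov (csucc c) l <= ucov s l.
Proof.
move=> s_inf sc ts cl [Yc Ycov]; rewrite -[X in card_of_set Y <= X](carrierK l).
have [l0 _] : exists f : nat -> l, injective f.
  by apply/card_of_leP; rewrite carrierK; exact: le_trans (le_trans s_inf sc) cl.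
move=> /(card_of_set_leP _ (l0 0%N))[j jinj].
rewrite /ucov; have [X [Xs Xcov] <-] := @cov_attained l s _ card2_le_aleph0.
pose U (x : l -> Prop) a := exists2 y, Y y /\ x (j y) & y a.
pose Z z := exists2 x, X x & U x = z.
have ZX : card_of_set Z <= card_of_set X by exact: (@card_of_set_le_image _ _ _ _ U).
apply: le_trans ZX; apply: cov_le; split=> [_ [x Xx <-]|b bc].
  split=> //; rewrite lt_csucc; apply: card_of_bigcup_le; first exact: le_trans sc.
    apply: le_trans (le_trans (ltW (Xs x Xx).2) sc).
    apply: (@card_of_set_le_inj _ _ _ _ j) => [y []//|y y' [Yy _] [Yy' _]].
    exact: jinj.
  by move=> y [Yy _]; rewrite -lt_csucc; exact: (Yc y Yy).2.
have [Q [QY Qt] Qcov] := Ycov b bc.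
have [|P [PX Pfin] Pcov] := Xcov (fun v => exists2 y, Q y & j y = v).
  split=> //; apply: lt_le_trans ts; apply: le_lt_trans Qt.
  exact: (@card_of_set_le_image _ _ _ _ j).
exists (fun z => exists2 x, P x & U x = z).
  split=> [_ [x /PX Xx <-]|]; first by exists x.
  by apply: le_lt_trans Pfin; exact: (@card_of_set_le_image _ _ _ _ U).
move=> a /Qcov[y Qy ya]; have [|x Px xy] := Pcov (j y); first by exists y.
by exists (U x); [exists x|exists y => //; split=> //; exact: QY].
Qed.

(** Bad sets [b t] for cofinally many [t < c] can be merged into one set of size
    at most [c], which is then bad for all [t < c], although it is covered by
    fewer than [c] members of [Y]. *)
Lemma covering_uniform (c l : cardinal) (Y : (l -> Prop) -> Prop) :
  aleph0 < c -> limit_cardinal c -> covering (csucc c) (csucc c) c Y ->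
  exists2 t, t < c & covering (csucc c) (csucc c) t Y.
Proof.
move=> c_unc [_ c_lim] [Yc Ycov]; apply: contrapT => nt.
have /choice[b bP] : forall t, exists b : l -> Prop, t < c ->
    card_of_set b <= c /\ forall Q : (l -> Prop) -> Prop, (forall y, Q y -> Y y) ->
      (forall a, b a -> exists2 y, Q y & y a) -> t <= card_of_set Q.
  move=> t; have [tc|] := boolP (t < c); last by exists (fun=> False).
  apply: contrapT => nb; apply: nt; exists t => //; split=> // b [_ bc].
  apply: contrapT => nQ; apply: nb; exists b => _; split=> [|Q QY Qcov].
    by rewrite -lt_csucc.
  by rewrite leNgt; apply/negP => Qt; apply: nQ; exists Q.
have [h [hc hcof]] := cofinal_cardinals c_unc.
have [|Q [QY Qc] Qcov] := Ycov (fun a => exists2 x : c, True & b (h x) a).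
  split=> //; rewrite lt_csucc; apply: card_of_bigcup_le => [||x _].
  - exact: ltW.
  - by rewrite (card_of_setT c) carrierK.
  - exact: (bP _ (hc x)).1.
(* [c] is a limit, so some bad set needs more than [card_of_set Q] members. *)
have [x] := hcof _ (c_lim _ Qc); rewrite leNgt => /negP; apply.
rewrite lt_csucc; apply: (bP _ (hc x)).2 => // a ba.
by apply: Qcov; exists x.
Qed.

Lemma covering_mono4 (r1 r2 r3 r4 r4' : cardinal) (X : (r1 -> Prop) -> Prop) :
  r4 <= r4' -> covering r2 r3 r4 X -> covering r2 r3 r4' X.
Proof.
move=> le4 [Xr2 Xcov]; split=> // b /Xcov[Q [QX Q4] Qcov].
by exists Q => //; split=> //; exact: lt_le_trans le4.
Qed.

Theorem corollary5p3 (chi lambda : cardinal) (chi_uncountable : aleph0 < chi)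
  (chi_limit : limit_cardinal chi) (chi_lt_lambda : chi < lambda)
  (chi_revision : revision_cardinal lambda (csucc chi)) :
  exists sigma0 : cardinal, [/\ aleph0 <= sigma0, sigma0 < chi &
    forall sigma : cardinal, sigma0 <= sigma -> sigma < chi ->
      ucov sigma lambda = Order.max (ucov sigma chi) (ucov (csucc chi) lambda)].
Proof.
have [_ _ [rho [rho2 rho_lt Yle]]] := chi_revision.
have [Y Ycov Ycard] := @cov_attained lambda (csucc chi) rho rho2.
rewrite -Ycard in Yle; rewrite lt_csucc in rho_lt.
have [tau tau_lt Ytau] := covering_uniform chi_uncountable chi_limit
  (covering_mono4 rho_lt Ycov).
exists (Order.max aleph0 tau); split=> [||sigma].
- by rewrite le_max lexx.
- by rewrite gt_max chi_uncountable.
rewrite ge_max => /andP[sigma_inf tau_le] sigma_lt.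
apply/eqP; rewrite eq_le ucov_le_max //= ge_max; apply/andP; split.
  by apply: cov_mono1; [exact: card2_le_aleph0|exact: ltW].
exact: ucov_csucc_le (ltW sigma_lt) tau_le (ltW chi_lt_lambda) Ytau Yle.
Qed.
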